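(* Let $H$ be a graph that is $S$-non-trivial for some $S\subseteq V(H)$ with $|S|\le 1$. Then the following problem is solvable in polynomial time: given a graph $G$, decide whether $H$ is an induced minor of $G$.
   Context: All graphs are finite, simple and undirected. $H$ is an induced minor of $G$ if $H$ can be obtained from $G$ by deleting vertices and contracting edges. An induced minor model of $H$ in $G$ is a collection $\{X_w : w\in V(H)\}$ of pairwise disjoint non-empty subsets of $V(G)$ such that each $G[X_w]$ is connected, and for distinct $w,w'$, $X_w$ and $X_{w'}$ are joined by an edge of $G$ if and only if $ww'\in E(H)$. For $S\subseteq V(H)$, $H$ is $S$-non-trivial if for every graph $G$ having $H$ as an induced minor, there exists an induced minor model $\{X_w\}$ of $H$ in $G$ with $|X_w|=1$ for every $w\in V(H)\setminus S$. The graph $H$ is fixed; polynomial time is in the size of $G$. *)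

(* Defs.v *)
From mathcomp Require Import all_boot.

Set Implicit Arguments.
Unset Strict Implicit.
Unset Printing Implicit Defensive.

(** * Finite simple graphs *)

Record sgraph := SGraph {
  vertex :> finType;
  edge : rel vertex;
  edge_sym : symmetric edge;
  edge_irrefl : irreflexive edge }.

Definition graph_iso (G H : sgraph) : Prop :=
  exists2 f : G -> H,
    bijective f & forall x y : G, edge (f x) (f y) = edge x y.

Section VertexDeletion.
Variables (G : sgraph) (v : G).

Definition del_edge : rel {x : G | x != v} :=
  fun x y => edge (val x) (val y).

Lemma del_edge_sym : symmetric del_edge.
Proof. by move=> x y; rewrite /del_edge edge_sym. Qed.

Lemma del_edge_irrefl : irreflexive del_edge.
Proof. by move=> x; rewrite /del_edge edge_irrefl. Qed.

Definition del_vertex : sgraph := SGraph del_edge_sym del_edge_irrefl.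
End VertexDeletion.

(** The edge [u v] is contracted onto [u]: the vertex [v] disappears and [u]
    inherits its neighbours, without loops or parallel edges. *)
Section EdgeContraction.
Variables (G : sgraph) (u v : G).

Definition contract_rel : rel G := fun x y =>
  (x != y) &&
  [|| edge x y, (x == u) && edge v y | (y == u) && edge x v].

Definition contract_edge_rel : rel {x : G | x != v} :=
  fun x y => contract_rel (val x) (val y).

Lemma contract_edge_sym : symmetric contract_edge_rel.
Proof.
move=> x y; rewrite /contract_edge_rel /contract_rel eq_sym.
rewrite (edge_sym (val x) (val y)) (edge_sym v (val y)) (edge_sym (val x) v).
by congr (_ && (_ || _)); rewrite orbC.
Qed.

Lemma contract_edge_irrefl : irreflexive contract_edge_rel.
Proof. by move=> x; rewrite /contract_edge_rel /contract_rel eqxx. Qed.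

Definition contract_edge : sgraph :=
  SGraph contract_edge_sym contract_edge_irrefl.
End EdgeContraction.

(** * Induced minors *)

Inductive induced_minor (H : sgraph) : sgraph -> Prop :=
| IM_iso (G : sgraph) :
    graph_iso G H -> induced_minor H G
| IM_delete (G : sgraph) (v : G) :
    induced_minor H (del_vertex v) -> induced_minor H G
| IM_contract (G : sgraph) (u v : G) :
    edge u v -> induced_minor H (contract_edge u v) -> induced_minor H G.

Definition connected_in (G : sgraph) (X : {set G}) : Prop :=
  {in X &, forall x y,
    connect [rel a b : G | [&& a \in X, b \in X & edge a b]] x y}.

Definition induced_minor_model (H G : sgraph) (X : H -> {set G}) : Prop :=
  [/\ forall w, X w != set0,
      forall w w', w != w' -> [disjoint X w & X w'],
      forall w, connected_in (X w)
    & forall w w', w != w' ->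
        ((exists2 x, x \in X w & exists2 y, y \in X w' & edge x y)
         <-> edge w w')].

Definition non_trivial (H : sgraph) (S : {set H}) : Prop :=
  forall G : sgraph, induced_minor H G ->
    exists2 X : H -> {set G},
      induced_minor_model X & forall w, w \notin S -> #|X w| = 1.

(** * Polynomial time *)

(** Deterministic random access machine.  Registers [r], [a], [b] are named by
    constants; the memory is addressed through registers.  The arithmetic is
    limited to addition and (truncated) subtraction, so that the number of
    executed instructions is polynomially related to the running time of a
    Turing machine (Cook and Reckhow, 1973). *)
Inductive instr :=
| IConst (r c : nat)
| IAdd (r a b : nat)
| ISub (r a b : nat)
| ILoad (r a : nat)
| IStore (a r : nat)
| IJump (l : nat)
| IJumpZ (r l : nat).

Definition program := seq instr.

Record config := Config { pc : nat; reg : nat -> nat; mem : nat -> nat }.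

Definition upd (f : nat -> nat) (i x : nat) : nat -> nat :=
  fun j => if j == i then x else f j.

Definition exec (i : instr) (s : config) : config :=
  let: Config l R M := s in
  match i with
  | IConst r c => Config l.+1 (upd R r c) M
  | IAdd r a b => Config l.+1 (upd R r (R a + R b)) M
  | ISub r a b => Config l.+1 (upd R r (R a - R b)) M
  | ILoad r a => Config l.+1 (upd R r (M (R a))) M
  | IStore a r => Config l.+1 R (upd M (R a) (R r))
  | IJump l' => Config l' R M
  | IJumpZ r l' => Config (if R r == 0 then l' else l.+1) R M
  end.

Definition halted (p : program) (s : config) : bool := size p <= pc s.

Definition step (p : program) (s : config) : config :=
  if onth p (pc s) is Some i then exec i s else s.

(** The input word is in memory cells [0 .. size w - 1] and its length is in
    register 0; everything else is zero. *)
Definition init (w : seq bool) : config :=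
  Config 0 (upd (fun=> 0) 0 (size w)) (fun a => nat_of_bool (nth false w a)).

Definition accepting (s : config) : Prop := reg s 0 <> 0.

(** The problem "given [x : T], does [P x] hold?", instances being presented to
    the machine through [enc], is decided in time polynomial in the length of
    the encoding. *)
Definition polytime_decidable (T : Type) (enc : T -> seq bool)
    (P : T -> Prop) : Prop :=
  exists (p : program) (c k : nat), forall x : T, exists t : nat,
    let s := iter t (step p) (init (enc x)) in
    [/\ t <= c * size (enc x) ^ k + c,
        halted p s
      & accepting s <-> P x].

(** Row-major adjacency matrix. *)
Definition adjacency_matrix (G : sgraph) : seq bool :=
  [seq edge x y | x <- enum G, y <- enum G].

(* Main.v *)
Require Import Defs.
From mathcomp Require Import all_boot zify.

Set Implicit Arguments.
Unset Strict Implicit.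
Unset Printing Implicit Defensive.

(** If [H] is nonempty we may take [S = {s}].  Guess the singleton bags [a w],
    [w != s], a vertex [a s] of the bag of [s] and, for every neighbour [w] of
    [s], a vertex [b w] of that bag adjacent to [a w]: there are at most
    [#|G| ^ (2 #|H|)] guesses.  A vertex may lie in the bag of [s] unless it is
    some [a w], or is adjacent to [a w] for a non-neighbour [w] of [s]; so a
    guess extends to a model iff each [b w] is reachable from [a s] through
    such vertices, the bag of [s] being then the whole component of [a s].

    The resulting algorithm is written in a small imperative language whose
    loops all run [N] times, [N] being the length of the input; hence every
    program of that language compiles to a polynomial-time machine. *)

(** * Models and induced minors *)

(** An edge may be sent to a path, possibly of length zero: a contracted edge collapses to a
    point. *)
Lemma connect_map (T U : finType) (e : rel T) (e' : rel U) (h : T -> U) :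
  (forall x y, e x y -> connect e' (h x) (h y)) ->
  forall x y, connect e x y -> connect e' (h x) (h y).
Proof.
move=> eh x y /connectP[p + ->]; elim: p x => [|z p IH] x //= /andP[xz zp].
exact: connect_trans (eh _ _ xz) (IH _ zp).
Qed.

Section ModelToMinor.
Variables (H G : sgraph) (X : H -> {set G}).
Hypothesis modelX : induced_minor_model X.

Let X_inj w w' x : x \in X w -> x \in X w' -> w = w'.
Proof.
have [_ disjX _ _] := modelX; move=> xw xw'.
case: (eqVneq w w') => // /disjX /pred0P /(_ x) /=.
by rewrite xw xw'.
Qed.

Lemma model_del_vertex v : (forall w, v \notin X w) ->
  induced_minor_model (H := H) (G := del_vertex v)
    (fun w => [set x : {x : G | x != v} | val x \in X w]).
Proof.
have [X0 disjX connX adjX] := modelX; move=> vX.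
have Xv w x : x \in X w -> x != v by apply: contraTneq => ->.
split=> [w|w w' ww'|w|w w' ww'].
- have /set0Pn[x xw] := X0 w; apply/set0Pn.
  by exists (Sub x (Xv w x xw)); rewrite inE.
- apply/pred0P => x /=; rewrite !inE; apply/negP => /andP[xw xw'].
  by move/eqP: ww'; apply; apply: X_inj xw xw'.
- move=> x y; rewrite !inE => xw yw.
  have := connX w _ _ xw yw.
  (* The default [x] of [insubd] is not reached on these edges: both ends lie in the bag, hence
     differ from [v]. *)
  move/(connect_map (h := insubd x)); rewrite !valKd; apply=> a b /=.
  case/and3P=> aw bw ab; apply: connect1 => /=.
  by rewrite !inE /del_edge !val_insubd !(Xv w) // aw bw.
- split=> [[x xw [y yw xy]]|/adjX - /(_ ww') [x xw [y yw xy]]].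
    by apply/adjX => //; rewrite !inE in xw yw; exists (val x); last exists (val y).
  exists (Sub x (Xv w x xw)); rewrite ?inE //.
  by exists (Sub y (Xv w' y yw)); rewrite ?inE.
Qed.

(** Both ends lie in one bag, so [u] stands in for [v] wherever the latter witnessed nonemptiness,
    connectedness or adjacency. *)
Lemma model_contract_edge w0 u v : u \in X w0 -> v \in X w0 -> edge u v ->
  induced_minor_model (H := H) (G := contract_edge u v)
    (fun w => [set x : {x : G | x != v} | val x \in X w]).
Proof.
have [X0 disjX connX adjX] := modelX; move=> uw vw uv.
have uNv : u != v by apply: contraTneq uv => ->; rewrite edge_irrefl.
pose u' : {x : G | x != v} := Sub u uNv.
split=> [w|w w' ww'|w|w w' ww'].
- have /set0Pn[x xw] := X0 w; apply/set0Pn.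
  case: (eqVneq x v) => [xv|xNv]; last by exists (Sub x xNv); rewrite inE.
  by exists u'; rewrite inE /= (X_inj (w := w) (w' := w0) (x := v)) // -xv.
- apply/pred0P => x /=; rewrite !inE; apply/negP => /andP[xw xw'].
  by move/eqP: ww'; apply; apply: X_inj xw xw'.
- move=> x y; rewrite !inE => xw yw.
  have := connX w _ _ xw yw.
  (* [insubd u'] is the retraction that sends [v] to [u] and fixes every other vertex. *)
  move/(connect_map (h := insubd u')); rewrite !valKd; apply=> a b /=.
  case/and3P=> aw bw ab.
  have uin c : c \in X w -> val (insubd u' c) \in X w.
    move=> cw; rewrite val_insubd; case: eqP => //= cv.
    by rewrite (X_inj cw (w' := w0)) // cv.
  case: (eqVneq (insubd u' a) (insubd u' b)) => [->|ab']; first exact: connect0.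
  apply: connect1 => /=; rewrite !inE !uin //= /contract_edge_rel /contract_rel.
  rewrite (inj_eq val_inj) ab' /= !val_insubd.
  case: (eqVneq a v) ab => [->|av]; case: (eqVneq b v) => [->|bv] //= ab.
  + by rewrite edge_irrefl in ab.
  + by rewrite eqxx ab orbT.
  + by rewrite eqxx ab !orbT.
  + by rewrite ab.
- split=> [[x xw [y yw xy]]|/adjX - /(_ ww') [x xw [y yw xy]]].
    apply/adjX => //; rewrite !inE in xw yw.
    move: xy; rewrite /= /contract_edge_rel /contract_rel => /andP[_].
    case/or3P=> [xy|/andP[/eqP xu vy]|/andP[/eqP yu xv]].
    + by exists (val x); last exists (val y).
    + exists v; last by exists (val y).
      by rewrite (X_inj (w := w) (w' := w0) (x := u)) // -xu.
    + exists (val x) => //; exists v => //.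
      by rewrite (X_inj (w := w') (w' := w0) (x := u)) // -yu.
  have neq a b : a \in X w -> b \in X w' -> a != b.
    by move=> aw bw; apply: contra_neq ww' => ab; apply: X_inj aw _; rewrite ab.
  case: (eqVneq x v) => [xv|xNv]; last case: (eqVneq y v) => [yv|yNv].
  + have uwx : u \in X w by rewrite (X_inj (w := w) (w' := w0) (x := x)) // xv.
    have yNv : y != v by rewrite -xv eq_sym neq.
    exists u'; rewrite ?inE //; exists (Sub y yNv); rewrite ?inE //=.
    by rewrite /contract_edge_rel /contract_rel /= neq // eqxx -xv xy orbT.
  + have uwy : u \in X w' by rewrite (X_inj (w := w') (w' := w0) (x := y)) // yv.
    exists (Sub x xNv); rewrite ?inE //; exists u'; rewrite ?inE //=.
    by rewrite /contract_edge_rel /contract_rel /= neq // eqxx -yv xy !orbT.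
  + exists (Sub x xNv); rewrite ?inE //; exists (Sub y yNv); rewrite ?inE //=.
    by rewrite /contract_edge_rel /contract_rel /= neq // xy.
Qed.

Lemma model_iso :
  (forall x, exists w, x \in X w) -> (forall w, #|X w| <= 1) -> graph_iso G H.
Proof.
have [X0 disjX connX adjX] := modelX; move=> cov small.
have cov' x : exists w, x \in X w by have [w] := cov x; exists w.
pose f x := xchoose (cov' x).
have fP x : x \in X (f x) by apply: (xchooseP (cov' x)).
have X1 w : exists x, x \in X w by apply/set0Pn.
pose g w := xchoose (X1 w).
have gP w : g w \in X w by apply: (xchooseP (X1 w)).
have fx w x : x \in X w -> f x = w by apply: X_inj (fP x).
have Xeq w x y : x \in X w -> y \in X w -> x = y.
  by move=> xw yw; have /card_le1_eqP := small w; apply.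
exists f => [|x y].
  exists g => [x|w]; last exact: fx.
  by apply: (Xeq (f x)); [apply: gP | apply: fP].
case: (eqVneq (f x) (f y)) => [fxy|fxy].
  have -> : x = y by apply: (Xeq (f y)); [rewrite -fxy; apply: fP | apply: fP].
  by rewrite !edge_irrefl.
apply/idP/idP => [/adjX - /(_ fxy) [a ax [b bY ab]]|xy].
  by rewrite (Xeq _ _ _ (fP x) ax) (Xeq _ _ _ (fP y) bY).
by apply/adjX => //; exists x => //; exists y.
Qed.

End ModelToMinor.

(** Induction on the number of vertices. A vertex outside all bags is deleted; failing that, an edge
    inside a bag with at least two vertices is contracted; failing both, the bags are singletons
    covering [G]. *)
Lemma model_induced_minor (H G : sgraph) (X : H -> {set G}) :
  induced_minor_model X -> induced_minor H G.
Proof.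
have [n] := ubnP #|G|; elim: n G X => // n IH G X Gn modelX.
have smaller (v : G) : #|{: {x : G | x != v}}| < n.
  rewrite card_sig; move: Gn; rewrite ltnS; apply: leq_trans.
  apply: proper_card; apply/properP.
  by split; [apply/subsetP | exists v; rewrite ?inE ?eqxx].
case: (pickP [pred v | [forall w, v \notin X w]]) => [v /forallP vX|cov].
  apply: (IM_delete (v := v)); apply: IH (model_del_vertex modelX vX).
  exact: smaller.
case: (pickP [pred w | 1 < #|X w|]) => [w /card_gt1P[x [y [xw yw xy]]]|small].
  have [_ _ connX _] := modelX.
  (* The edge to contract is the first one of a path from [x] to [y] inside the bag. *)
  have /connectP[[|z p] /=] := connX w x y xw yw.
    by move=> _ e; rewrite e eqxx in xy.
  case/andP=> /and3P[_ zw xz] _ _.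
  apply: (IM_contract xz); apply: IH (model_contract_edge modelX xw zw xz).
  exact: smaller.
apply: IM_iso; apply: (model_iso modelX) => [x|w].
  by have /negbT/forallPn[w] := cov x; rewrite negbK; exists w.
by rewrite leqNgt; have /negbT := small w.
Qed.

(** * Certificates for models whose bags are singletons except at [s] *)

Section OneBag.
Variables (H G : sgraph) (s : H).

Definition allowed (a : H -> G) (y : G) : bool :=
  [forall w, (w != s) ==> (y != a w) && (edge s w || ~~ edge y (a w))].

(** Only the target is tested: a walk that starts at an allowed vertex stays among allowed
    vertices. *)
Definition bag_rel (a : H -> G) : rel G := fun x y => edge x y && allowed a y.

(** [a w] is the singleton bag of [w != s], [a s] a vertex of the bag of [s],
    and [b w] a neighbour of [a w] in the bag of [s]. *)
Definition certificate (a b : H -> G) : Prop :=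
  [/\ forall w w', w != s -> w' != s -> w != w' ->
        a w != a w' /\ edge (a w) (a w') = edge w w',
      allowed a (a s)
    & forall w, w != s -> edge s w ->
        connect (bag_rel a) (a s) (b w) /\ edge (b w) (a w)].

(** The bag of [s] is everything reachable from [a s]. Taking all of it is safe, since allowed
    vertices avoid every [a w] and touch only those with [w] a neighbour of [s]. *)
Lemma certificate_model a b : certificate a b ->
  exists X : H -> {set G}, induced_minor_model X.
Proof.
case=> inda alls conn.
pose C := [set y | connect (bag_rel a) (a s) y].
have C_allowed y : y \in C -> allowed a y.
  rewrite inE => /connectP[p + ->]; elim/last_ind: p => [|p z _] //=.
  by rewrite rcons_path last_rcons => /andP[_ /andP[]].
have asC : a s \in C by rewrite inE connect0.
pose X w := if w == s then C else [set a w].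
have Xs : X s = C by rewrite /X eqxx.
have Xw w : w != s -> X w = [set a w] by rewrite /X => /negbTE ->.
have CNa y w : y \in C -> w != s -> y != a w.
  by move=> /C_allowed/forallP/(_ w)/implyP aly ws; case/andP: (aly ws).
have adjs w : w != s -> (exists2 x, x \in C & edge x (a w)) <-> edge s w.
  move=> ws; split=> [[x xC xw]|sw].
    have /forallP/(_ w)/implyP/(_ ws)/andP[_] := C_allowed x xC.
    by rewrite xw orbF.
  by have [cb bw] := conn w ws sw; exists (b w); rewrite ?inE.
exists X; split=> [w|w w' ww'|w|w w' ww'].
- case: (eqVneq w s) => [->|ws]; apply/set0Pn.
    by exists (a s); rewrite Xs.
  by exists (a w); rewrite Xw // inE.
- apply/pred0P => x /=; apply/negP => /andP[].
  case: (eqVneq w s) ww' => [->|ws]; case: (eqVneq w' s) => [->|ws'] ww'.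
  + by [].
  + by rewrite Xs Xw // => xC /set1P xa; have := CNa x w' xC ws'; rewrite xa eqxx.
  + by rewrite Xs Xw // => /set1P xa xC; have := CNa x w xC ws; rewrite xa eqxx.
  + rewrite !Xw // => /set1P -> /set1P e.
    by have [] := inda w w' ws ws' ww'; rewrite e eqxx.
- case: (eqVneq w s) => [->|ws]; last first.
    by rewrite Xw // => x y /set1P -> /set1P ->; apply: connect0.
  rewrite Xs; pose e := [rel x y : G | [&& x \in C, y \in C & edge x y]].
  (* [bag_rel] need not be symmetric, but adjacency inside [C] is, so it is enough to reach each
     vertex of [C] from [a s]. *)
  have e_sym : connect_sym e.
    by apply: sym_connect_sym => x y /=; rewrite edge_sym andbCA.
  suff from_a y : y \in C -> connect e (a s) y.
    move=> x y xC yC; apply: connect_trans (from_a y yC).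
    by rewrite -/e e_sym from_a.
  rewrite inE => /connectP[p + ->]; elim/last_ind: p => [|p z IH] //=.
  rewrite rcons_path last_rcons => /andP[pp pz]; apply: connect_trans (IH pp) _.
  have lC : connect (bag_rel a) (a s) (last (a s) p) by apply/connectP; exists p.
  apply: connect1; rewrite /= !inE lC (connect_trans lC (connect1 pz)).
  by case/andP: pz.
- case: (eqVneq w s) ww' => [->|ws]; case: (eqVneq w' s) => [->|ws'] ww'.
  + by [].
  + rewrite Xs Xw //; split=> [[x xC [y /set1P -> xy]]|/(adjs _ ws')[x xC xy]].
      by apply/(adjs _ ws'); exists x.
    by exists x => //; exists (a w'); rewrite ?set11.
  + rewrite Xs Xw //; split=> [[x /set1P -> [y yC xy]]|].
      by rewrite edge_sym; apply/(adjs _ ws); exists y; rewrite // edge_sym.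
    rewrite edge_sym => /(adjs _ ws)[x xC xy].
    by exists (a w); rewrite ?set11 //; exists x; rewrite // edge_sym.
  + have [_ <-] := inda w w' ws ws' ww'; rewrite !Xw //.
    split=> [[x /set1P -> [y /set1P -> xy]]|aw] //.
    by exists (a w); rewrite ?set11 //; exists (a w'); rewrite ?set11.
Qed.

(** Every vertex of the bag of [s] is allowed, so a walk inside that bag is a walk for [bag_rel]. *)
Lemma model_certificate (X : H -> {set G}) :
  induced_minor_model X -> (forall w, w != s -> #|X w| = 1) ->
  exists a b, certificate a b.
Proof.
move=> [X0 disjX connX adjX] X1.
have Xex w : exists x, x \in X w by apply/set0Pn.
pose a w := xchoose (Xex w).
have aX w : a w \in X w by apply: xchooseP.
have Xa w : w != s -> X w = [set a w].
  by move=> /X1/eqP/cards1P[x E]; have := aX w; rewrite E => /set1P ->.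
have Xs_allowed y : y \in X s -> allowed a y.
  move=> ys; apply/forallP => w; apply/implyP => ws; apply/andP; split.
    apply: contraTneq ys => ->; have := disjX w s ws.
    by rewrite disjoints_subset => /subsetP/(_ _ (aX w)); rewrite inE.
  rewrite -implyNb; apply/implyP; apply: contra => yw.
  by apply/adjX; rewrite 1?eq_sym //; exists y => //; exists (a w).
(* An implication, so that [b] is total; [a s] is a filler where no contact vertex is required. *)
have bex w : exists y, (edge s w && (w != s)) ==> (y \in X s) && edge y (a w).
  case: (boolP (edge s w && (w != s))) => [/andP[sw ws]|_]; last by exists (a s).
  move: sw => /adjX; rewrite eq_sym => /(_ ws)[y ys [z + yz]].
  by rewrite Xa // => /set1P za; exists y; rewrite ys -za yz.
pose b w := xchoose (bex w).
exists a, b; split=> [w w' ws ws' ww'||w ws sw].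
- split.
    apply/negP => /eqP e; have := disjX w w' ww'.
    by rewrite disjoints_subset => /subsetP/(_ _ (aX w)); rewrite inE e aX.
  apply/idP/idP => [aw|/(adjX _ _ ww')].
    by apply/adjX => //; exists (a w) => //; exists (a w').
  by rewrite !Xa // => -[x /set1P -> [y /set1P ->]].
- exact: Xs_allowed.
have /implyP/(_ (introT andP (conj sw ws)))/andP[bs bw] := xchooseP (bex w).
split=> //; apply: connect_sub (connX s _ _ (aX s) bs) => x y /=.
by case/and3P=> _ ys xy; apply: connect1; rewrite /bag_rel xy Xs_allowed.
Qed.

End OneBag.

(** * Compilation of bounded-loop programs *)

Inductive expr :=
| Var (x : nat) | Cst (c : nat) | Len
| Plus (e f : expr) | Minus (e f : expr) | Deref (e : expr).

Inductive cmd :=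
| Asgn (x : nat) (e : expr)
| Store (e f : expr)
| Seq (c c' : cmd)
| When (e : expr) (c : cmd)
| For (x : nat) (c : cmd).

Definition state := ((nat -> nat) * (nat -> nat))%type.

Section Semantics.
Variable N : nat.

Fixpoint eval (st : state) (e : expr) : nat :=
  match e with
  | Var x => st.1 x
  | Cst c => c
  | Len => N
  | Plus e f => eval st e + eval st f
  | Minus e f => eval st e - eval st f
  | Deref e => st.2 (eval st e)
  end.

(** The range of a loop is fixed in advance and its variable is reset in each round, so the body
    cannot change the number of rounds. *)
Fixpoint den (c : cmd) (st : state) : state :=
  match c with
  | Asgn x e => (upd st.1 x (eval st e), st.2)
  | Store e f => (st.1, upd st.2 (eval st e) (eval st f))
  | Seq c c' => den c' (den c st)
  | When e c => if eval st e == 0 then st else den c st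
  | For x c =>
      foldl (fun st' j => den c (upd st'.1 x j, st'.2)) st (iota 0 N)
  end.

(** The index of [I] counts completed rounds, hence equals the value that [x] receives in the next
    one. *)
Lemma for_ind (I : nat -> state -> Prop) x c st :
  I 0 st ->
  (forall j st', j < N -> I j st' -> I j.+1 (den c (upd st'.1 x j, st'.2))) ->
  I N (den (For x c) st).
Proof.
move=> I0 IS /=.
suff H k j st' : j + k = N -> I j st' ->
  I N (foldl (fun st' j => den c (upd st'.1 x j, st'.2)) st' (iota j k)).
  exact: (H N 0).
elim: k j st' => [|k IH] j st' /= jk Ij; first by rewrite -jk addn0.
apply: IH; first by rewrite -jk addSnnS.
by apply: IS => //; rewrite -jk -addSnnS leq_addr.
Qed.

End Semantics.

(** User variables live in the odd registers; the even ones serve as an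
    evaluation stack whose bottom, register 0, keeps the input length. *)
Definition uvar x := x.*2.+1.
Definition hid d := d.*2.

(** [d] is the height of the evaluation stack: the value ends in [hid d] and the entries below
    survive, among them a pending left operand. A register copy is a zeroing followed by an
    addition. *)
Fixpoint cexp (d : nat) (e : expr) : program :=
  match e with
  | Var x => [:: IConst (hid d) 0; IAdd (hid d) (hid d) (uvar x)]
  | Cst c => [:: IConst (hid d) c]
  | Len => [:: IConst (hid d) 0; IAdd (hid d) (hid d) (hid 0)]
  | Plus e f => cexp d e ++ cexp d.+1 f ++ [:: IAdd (hid d) (hid d) (hid d.+1)]
  | Minus e f => cexp d e ++ cexp d.+1 f ++ [:: ISub (hid d) (hid d) (hid d.+1)]
  | Deref e => cexp d e ++ [:: ILoad (hid d) (hid d)]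
  end.

(** [l] is the absolute address of the first instruction, needed for jump targets. In a loop [hid d]
    is the counter, safe because the body works from [hid d.+1] on; that register first holds the
    number of rounds left, and the loop ends when it is zero. The 8 counts five instructions before
    the body and three after it. *)
Fixpoint code (d l : nat) (c : cmd) : program :=
  match c with
  | Asgn x e =>
      cexp d e ++ [:: IConst (uvar x) 0; IAdd (uvar x) (uvar x) (hid d)]
  | Store e f => cexp d e ++ cexp d.+1 f ++ [:: IStore (hid d) (hid d.+1)]
  | Seq c c' => let b := code d l c in b ++ code d (l + size b) c'
  | When e c =>
      let b := cexp d e in
      let b' := code d (l + size b).+1 c in
      b ++ IJumpZ (hid d) ((l + size b).+1 + size b') :: b'
  | For x c =>
      let b := code d.+1 (l + 5) c in
      [:: IConst (hid d) 0; ISub (hid d.+1) (hid 0) (hid d);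
          IJumpZ (hid d.+1) (l + 8 + size b);
          IConst (uvar x) 0; IAdd (uvar x) (uvar x) (hid d)] ++ b ++
      [:: IConst (hid d.+1) 1; IAdd (hid d) (hid d) (hid d.+1); IJump l.+1]
  end.

Fixpoint ecost (e : expr) : nat :=
  match e with
  | Var _ | Len => 2
  | Cst _ => 1
  | Plus e f | Minus e f => ecost e + (ecost f + 1)
  | Deref e => ecost e + 1
  end.

(** An upper bound: [When] is always charged for its body. In a loop, 1 is the initialisation, 7 the
    overhead of a round and 2 the test that exits. *)
Fixpoint cost (N : nat) (c : cmd) : nat :=
  match c with
  | Asgn _ e => ecost e + 2
  | Store e f => ecost e + (ecost f + 1)
  | Seq c c' => cost N c + cost N c'
  | When e c => ecost e + (1 + cost N c)
  | For _ c => 1 + (N * (cost N c + 7) + 2)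
  end.

(** * Execution of compiled code on the machine *)

Definition runs (p : program) (b : nat) (s s' : config) : Prop :=
  exists2 t, t <= b & iter t (step p) s = s'.

Definition code_at (p : program) (l : nat) (q : program) : Prop :=
  exists q', drop l p = q ++ q'.

Lemma code_at_cat p l q q' :
  code_at p l (q ++ q') -> code_at p l q /\ code_at p (l + size q) q'.
Proof.
case=> r Er; split; first by exists (q' ++ r); rewrite catA.
by exists r; rewrite addnC -drop_drop Er -catA drop_size_cat.
Qed.

Lemma code_at_cons p l i q :
  code_at p l (i :: q) -> code_at p l [:: i] /\ code_at p l.+1 q.
Proof. by rewrite -cat1s => /code_at_cat; rewrite addn1. Qed.

Lemma runs_trans p b b' s s' s'' :
  runs p b s s' -> runs p b' s' s'' -> runs p (b + b') s s''.
Proof.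
case=> t tb <- [t' tb' <-]; exists (t' + t); last by rewrite iterD.
by rewrite addnC leq_add.
Qed.

Lemma runs_leq p b b' s s' : b <= b' -> runs p b s s' -> runs p b' s s'.
Proof. by move=> bb [t tb <-]; exists t => //; apply: leq_trans bb. Qed.

Lemma runs1 p l i R M :
  code_at p l [:: i] -> runs p 1 (Config l R M) (exec i (Config l R M)).
Proof.
case=> q E; exists 1 => //=; rewrite /step /=.
have -> : onth p l = Some i.
  by rewrite onthE -[l]addn0 -nth_drop -map_drop E.
by [].
Qed.

(** Hidden registers other than register 0 are left free here; [agree] controls those below the
    stack height. *)
Definition sim (N : nat) (st : state) (R : nat -> nat) : Prop :=
  R 0 = N /\ forall x, R (uvar x) = st.1 x.

Definition agree (d : nat) (R R' : nat -> nat) : Prop :=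
  forall k, k < d -> R' (hid k) = R (hid k).

Lemma agree_trans d R R' R'' : agree d R R' -> agree d R' R'' -> agree d R R''.
Proof. by move=> A B k kd; rewrite B // A. Qed.

Lemma agree_leq d d' R R' : d <= d' -> agree d' R R' -> agree d R R'.
Proof. by move=> dd A k kd; apply: A; apply: leq_trans dd. Qed.

Lemma agree_hid d R v : agree d R (upd R (hid d) v).
Proof. by move=> k kd; rewrite /upd /hid ifF //; lia. Qed.

Lemma agree_uvar d R x v : agree d R (upd R (uvar x) v).
Proof. by move=> k kd; rewrite /upd /hid /uvar ifF //; lia. Qed.

Lemma sim_hid N st R d v : 0 < d -> sim N st R -> sim N st (upd R (hid d) v).
Proof.
move=> d0 [R0 Ru]; split=> [|x]; rewrite /upd /hid ?ifF //; try lia.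
by rewrite /uvar; lia.
Qed.

Lemma sim_uvar N st R x v :
  sim N st R -> sim N (upd st.1 x v, st.2) (upd R (uvar x) v).
Proof.
case=> R0 Ru; split=> [|y] //=; rewrite /upd /uvar.
have -> : (y.*2.+1 == x.*2.+1) = (y == x) by lia.
by case: eqP => // _; apply: Ru.
Qed.

Lemma upd_eq f i v : upd f i v i = v.
Proof. by rewrite /upd eqxx. Qed.

Lemma upd_neq f i v j : j != i -> upd f i v j = f j.
Proof. by rewrite /upd => /negbTE ->. Qed.

(** [0 < d] keeps register 0, the input length, off the stack. The clause [agree] carries the left
    operand through the evaluation of the right one. *)
Lemma cexp_correct N p e d l R st :
  0 < d -> code_at p l (cexp d e) -> sim N st R ->
  exists R', [/\ runs p (ecost e) (Config l R st.2)
                   (Config (l + size (cexp d e)) R' st.2),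
                 sim N st R', R' (hid d) = eval N st e & agree d R R'].
Proof.
elim: e d l R => [x|c||e IHe f IHf|e IHe f IHf|e IHe] d l R d0 /=.
- move=> /code_at_cons[c1 c2] S.
  have S1 := sim_hid 0 d0 S.
  exists (upd (upd R (hid d) 0) (hid d) (st.1 x)); split.
  + rewrite addn2; apply: runs_trans (runs1 _ _ c1) _ => /=.
    have := runs1 (upd R (hid d) 0) st.2 c2.
    by rewrite /= upd_eq (proj2 S1) add0n.
  + exact: sim_hid.
  + by rewrite upd_eq.
  + by apply: agree_trans (agree_hid _ _) (agree_hid _ _).
- move=> c1 S; exists (upd R (hid d) c); split.
  + by rewrite addn1; apply: runs1 c1.
  + exact: sim_hid.
  + by rewrite upd_eq.
  + exact: agree_hid.
- move=> /code_at_cons[c1 c2] S.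
  have S1 := sim_hid 0 d0 S.
  exists (upd (upd R (hid d) 0) (hid d) N); split.
  + rewrite addn2; apply: runs_trans (runs1 _ _ c1) _ => /=.
    have := runs1 (upd R (hid d) 0) st.2 c2.
    by rewrite /= upd_eq (proj1 S1) add0n.
  + exact: sim_hid.
  + by rewrite upd_eq.
  + by apply: agree_trans (agree_hid _ _) (agree_hid _ _).
- move=> /code_at_cat[c1 /code_at_cat[c2 c3]] S.
  have [R1 [r1 S1 E1 A1]] := IHe _ _ _ d0 c1 S.
  have [R2 [r2 S2 E2 A2]] := IHf _ _ _ (ltn0Sn d) c2 S1.
  exists (upd R2 (hid d) (eval N st e + eval N st f)); split.
  + apply: runs_trans r1 _; apply: runs_trans r2 _.
    by have := runs1 R2 st.2 c3; rewrite /= E2 A2 // E1 !size_cat /= !addnA addn1.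
  + exact: sim_hid.
  + by rewrite upd_eq.
  + apply: agree_trans A1 _; apply: agree_trans (agree_leq _ A2) _ => //.
    exact: agree_hid.
- move=> /code_at_cat[c1 /code_at_cat[c2 c3]] S.
  have [R1 [r1 S1 E1 A1]] := IHe _ _ _ d0 c1 S.
  have [R2 [r2 S2 E2 A2]] := IHf _ _ _ (ltn0Sn d) c2 S1.
  exists (upd R2 (hid d) (eval N st e - eval N st f)); split.
  + apply: runs_trans r1 _; apply: runs_trans r2 _.
    by have := runs1 R2 st.2 c3; rewrite /= E2 A2 // E1 !size_cat /= !addnA addn1.
  + exact: sim_hid.
  + by rewrite upd_eq.
  + apply: agree_trans A1 _; apply: agree_trans (agree_leq _ A2) _ => //.
    exact: agree_hid.
- move=> /code_at_cat[c1 c2] S.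
  have [R1 [r1 S1 E1 A1]] := IHe _ _ _ d0 c1 S.
  exists (upd R1 (hid d) (st.2 (eval N st e))); split.
  + apply: runs_trans r1 _.
    by have := runs1 R1 st.2 c2; rewrite /= E1 size_cat /= addnA addn1.
  + exact: sim_hid.
  + by rewrite upd_eq.
  + by apply: agree_trans A1 _; apply: agree_hid.
Qed.

Lemma code_correct N p c d l R st :
  0 < d -> code_at p l (code d l c) -> sim N st R ->
  exists R', [/\ runs p (cost N c) (Config l R st.2)
                   (Config (l + size (code d l c)) R' (den N c st).2),
                 sim N (den N c st) R' & agree d R R'].
Proof.
elim: c d l R st => [x e|e f|c IHc c' IHc'|e c IHc|x c IHc] d l R st d0 /=.
- move=> /code_at_cat[c1 /code_at_cons[c2 c3]] S.
  have [R1 [r1 S1 E1 A1]] := cexp_correct d0 c1 S.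
  have E2 : upd R1 (uvar x) 0 (hid d) = eval N st e.
    by rewrite upd_neq // /hid /uvar; lia.
  exists (upd (upd R1 (uvar x) 0) (uvar x) (eval N st e)); split.
  + apply: runs_trans r1 _; apply: runs_trans (runs1 _ _ c2) _ => /=.
    have := runs1 (upd R1 (uvar x) 0) st.2 c3.
    by rewrite /= upd_eq E2 add0n size_cat /= addnA addn2.
  (* Zeroing and then writing amounts, pointwise, to the single update of [sim_uvar]. *)
  + have [S2 S3] := sim_uvar x (eval N st e) S1.
    by split=> [|y]; [apply: etrans S2 | apply: etrans (S3 y)];
      rewrite /upd; case: (_ == _).
  + apply: agree_trans A1 _; apply: agree_trans (agree_uvar _ _ _) _.
    exact: agree_uvar.
- move=> /code_at_cat[c1 /code_at_cat[c2 c3]] S.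
  have [R1 [r1 S1 E1 A1]] := cexp_correct d0 c1 S.
  have [R2 [r2 S2 E2 A2]] := cexp_correct (ltn0Sn d) c2 S1.
  exists R2; split=> //.
  + apply: runs_trans r1 _; apply: runs_trans r2 _.
    by have := runs1 R2 st.2 c3; rewrite /= E2 A2 // E1 !size_cat /= !addnA addn1.
  + by apply: agree_trans A1 _; apply: agree_leq A2.
- move=> /code_at_cat[c1 c2] S.
  have [R1 [r1 S1 A1]] := IHc _ _ _ _ d0 c1 S.
  have [R2 [r2 S2 A2]] := IHc' _ _ _ _ d0 c2 S1.
  exists R2; split=> //; last exact: agree_trans A2.
  by rewrite size_cat addnA; apply: runs_trans r2.
- move=> /code_at_cat[c1 /code_at_cons[c2 c3]] S.
  have [R1 [r1 S1 E1 A1]] := cexp_correct d0 c1 S.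
  have r2 := runs1 R1 st.2 c2.
  rewrite /= E1 in r2.
  have sz i q : l + size (cexp d e ++ i :: q) = (l + size (cexp d e)).+1 + size q.
    by rewrite size_cat /=; lia.
  rewrite sz.
  case: (eval N st e == 0) r2 => r2.
    exists R1; split=> //.
    by apply: runs_leq (runs_trans r1 r2); rewrite leq_add2l leq_addr.
  have [R2 [r3 S2 A2]] := IHc _ _ _ _ d0 c3 S1.
  exists R2; split=> //; last exact: agree_trans A2.
  apply: runs_trans r1 _; apply: runs_trans r2 r3.
- move=> /code_at_cons[c1 /code_at_cons[c2 /code_at_cons[c3]]].
  move=> /code_at_cons[c4 /code_at_cons[c5 /code_at_cat[cb]]].
  move=> /code_at_cons[c6 /code_at_cons[c7 c8]] S.
  have El : l.+4.+1 = l + 5 by lia.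
  rewrite El in cb c6 c7 c8.
  set b := code d.+1 (l + 5) c in cb c6 c7 c8 c3 *.
  have -> : l + (size (b ++ [:: IConst (hid d.+1) 1;
      IAdd (hid d) (hid d) (hid d.+1); IJump l.+1])).+4.+1 = l + 8 + size b.
    by rewrite size_cat /=; lia.
  (* Generalised to [k] rounds left from counter value [j]; execution starts at [l.+1], the test to
     which each round jumps back. *)
  have loop k : forall j st' R', j + k = N -> sim N st' R' -> R' (hid d) = j ->
    exists R'', [/\ runs p (k * (cost N c + 7) + 2) (Config l.+1 R' st'.2)
        (Config (l + 8 + size b) R''
          (foldl (fun st' j => den N c (upd st'.1 x j, st'.2)) st' (iota j k)).2),
      sim N (foldl (fun st' j => den N c (upd st'.1 x j, st'.2)) st' (iota j k))
          R'' & agree d R' R''].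
    elim: k => [|k IHk] j st' R' jk S' Rj.
      exists (upd R' (hid d.+1) 0); split=> /=.
      + have := runs1 R' st'.2 c2.
        rewrite /= (proj1 S') Rj -jk addn0 subnn => r1.
        apply: runs_trans r1 _.
        by have := runs1 (upd R' (hid d.+1) 0) st'.2 c3; rewrite /= upd_eq.
      + exact: sim_hid.
      + exact: agree_leq (agree_hid _ _).
    have jN : N - j = k.+1 by lia.
    set R1 := upd R' (hid d.+1) k.+1.
    have S1 : sim N st' R1 by apply: sim_hid.
    have R1j : R1 (hid d) = j by rewrite /R1 upd_neq // /hid; lia.
    set R2 := upd R1 (uvar x) 0; set R3 := upd R2 (uvar x) j.
    have R2j : R2 (hid d) = j by rewrite /R2 upd_neq // /hid /uvar; lia.
    have S3 : sim N (upd st'.1 x j, st'.2) R3.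
      have [S2 S3] := sim_uvar x j S1.
      by split=> [|y]; [apply: etrans S2 | apply: etrans (S3 y)];
        rewrite /R3 /R2 /upd; case: (_ == _).
    have A3 : agree d R' R3.
      apply: agree_trans (agree_leq (leqnSn d) (agree_hid _ _)) _.
      exact: agree_trans (agree_uvar _ _ _) (agree_uvar _ _ _).
    have R3j : R3 (hid d) = j by rewrite /R3 upd_neq // /hid /uvar; lia.
    have [R4 [r4 S4 A4]] := IHc _ _ _ _ (ltn0Sn d) cb S3.
    have R4j : R4 (hid d) = j by rewrite A4.
    set R5 := upd R4 (hid d.+1) 1; set R6 := upd R5 (hid d) j.+1.
    have R5j : R5 (hid d) = j by rewrite /R5 upd_neq // /hid; lia.
    have S6 : sim N (den N c (upd st'.1 x j, st'.2)) R6.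
      by do 2![apply: sim_hid => //].
    have [R7 [r7 S7 A7]] := IHk j.+1 _ _ (etrans (addSnnS j k) jk) S6 (upd_eq _ _ _).
    exists R7; split=> //.
      (* The summands follow the instructions: two for the test, two to set the loop variable, the
         body, three to increment and jump back, then the remaining rounds. *)
      have <- : 1 + (1 + (1 + (1 + (cost N c + (1 + (1 + (1 +
          (k * (cost N c + 7) + 2)))))))) = k.+1 * (cost N c + 7) + 2 by lia.
      have := runs1 R' st'.2 c2; rewrite /= (proj1 S') Rj jN => r1.
      apply: runs_trans r1 _.
      have := runs1 R1 st'.2 c3; rewrite /= {2}/R1 upd_eq => r2.
      apply: runs_trans r2 _.
      apply: runs_trans (runs1 _ _ c4) _ => /=.
      have := runs1 R2 st'.2 c5; rewrite /= R2j {3}/R2 upd_eq add0n => r3.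
      apply: runs_trans r3 _.
      rewrite El; apply: runs_trans r4 _.
      apply: runs_trans (runs1 _ _ c6) _ => /=.
      have := runs1 R5 (den N c (upd st'.1 x j, st'.2)).2 c7.
      rewrite /= R5j {3}/R5 upd_eq addn1 => r5.
      apply: runs_trans r5 _.
      by apply: runs_trans (runs1 _ _ c8) _.
    apply: agree_trans A3 _; apply: agree_trans (agree_leq (leqnSn d) A4) _.
    apply: agree_trans (agree_leq (leqnSn d) (agree_hid _ _)) _.
    exact: agree_trans (agree_hid _ _) A7.
  have [R1 [r1 S1 A1]] := loop N 0 st (upd R (hid d) 0) erefl
    (sim_hid 0 d0 S) (upd_eq _ _ _).
  exists R1; split=> //; last exact: agree_trans (agree_hid _ _) A1.
  exact: runs_trans (runs1 _ _ c1) r1.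
Qed.

(** A loop raises the degree by one; a sequence adds degrees, which is crude but avoids a maximum.
    The base [N.+1] is positive, so constants are absorbed even for [N = 0]. *)
Lemma cost_poly c : exists C k, forall N, cost N c <= C * N.+1 ^ k.
Proof.
elim: c => [x e|e f|c [C [k H]] c' [C' [k' H']]|e c [C [k H]]|x c [C [k H]]].
- by exists (ecost e + 2), 0 => N; rewrite expn0 muln1.
- by exists (ecost e + (ecost f + 1)), 0 => N; rewrite expn0 muln1.
- exists (C + C'), (k + k') => N /=; rewrite expnD.
  have := H N; have := H' N.
  have : 0 < N.+1 ^ k by rewrite expn_gt0.
  have : 0 < N.+1 ^ k' by rewrite expn_gt0.
  nia.
- exists (ecost e + 1 + C), k => N /=.
  have := H N; have : 0 < N.+1 ^ k by rewrite expn_gt0.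
  nia.
- exists (C + 10), k.+1 => N /=; rewrite expnS.
  have := H N; have : 0 < N.+1 ^ k by rewrite expn_gt0.
  nia.
Qed.

Definition input (w : seq bool) : state :=
  (fun=> 0, fun a => nat_of_bool (nth false w a)).

(** Two instructions after the compiled code copy the answer to register 0, and the machine halts by
    running off the end. The factor [2 ^ k] comes from [N.+1 <= 2 * N] for positive [N]; the
    additive constant covers [N = 0]. *)
Lemma cmd_polytime_decidable (T : Type) (enc : T -> seq bool) (P : T -> Prop)
    (c : cmd) (ans : nat) :
  (forall x : T, (den (size (enc x)) c (input (enc x))).1 ans <> 0 <-> P x) ->
  polytime_decidable enc P.
Proof.
move=> cP; have [C [k Ck]] := cost_poly c.
pose q := code 1 0 c.
pose p := q ++ [:: IConst 0 0; IAdd 0 0 (uvar ans)].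
exists p, (C * 2 ^ k + 2), k => x; set w := enc x; set N := size w.
have S0 : sim N (input w) (upd (fun=> 0) 0 N) by [].
have c0 : code_at p 0 q.
  by exists [:: IConst 0 0; IAdd 0 0 (uvar ans)]; rewrite drop0.
have [R [r S _]] := code_correct (ltn0Sn 0) c0 S0.
have [c1 c2] : code_at p (size q) [:: IConst 0 0]
    /\ code_at p (size q).+1 [:: IAdd 0 0 (uvar ans)].
  by apply: code_at_cons; rewrite /code_at drop_size_cat //; exists [::].
have := runs_trans r (runs_trans (runs1 _ _ c1) (runs1 _ _ c2)).
case=> t tb it; exists t.
rewrite -/N -[init _]/(Config 0 (upd (fun=> 0) 0 N) (input w).2).
rewrite it; split.
- apply: leq_trans tb _; have := Ck N; case: (posnP N) => [->|N0].
    rewrite exp1n; have : 0 < 2 ^ k by rewrite expn_gt0.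
    nia.
  have : N.+1 ^ k <= 2 ^ k * N ^ k.
    rewrite -expnMn; case: k {Ck} => [|k]; first by [].
    by rewrite leq_exp2r //; lia.
  have : 0 < N ^ k by rewrite expn_gt0 N0.
  nia.
- by rewrite /halted /= size_cat /= addn2.
- by rewrite /accepting /= !upd_eq add0n upd_neq // (proj2 S); apply: cP.
Qed.

(** * The decision procedure *)

Fixpoint writes (c : cmd) (x : nat) : bool :=
  match c with
  | Asgn y _ => x == y
  | Store _ _ => false
  | Seq c c' => writes c x || writes c' x
  | When _ c => writes c x
  | For y c => (x == y) || writes c x
  end.

(** A syntactic test, decided by computation, that all stores go to addresses [2 N] and above: the
    matrix and the table of row addresses then survive. *)
Fixpoint stores_high (c : cmd) : bool :=
  match c with
  | Asgn _ _ => true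
  | Store e _ => if e is Plus (Plus Len Len) _ then true else false
  | Seq c c' => stores_high c && stores_high c'
  | When _ c | For _ c => stores_high c
  end.

Lemma den_writes N c x st : ~~ writes c x -> (den N c st).1 x = st.1 x.
Proof.
elim: c st => [y e|e f|c IHc c' IHc'|e c IHc|y c IHc] st.
- by move=> xy; rewrite /= upd_neq.
- by [].
- by rewrite /= negb_or => /andP[xc xc']; rewrite IHc' // IHc.
- by move=> xc /=; case: ifP => // _; apply: IHc.
- rewrite [writes _ _]/= negb_or => /andP[xy xc].
  apply: (@for_ind N (fun _ st' => st'.1 x = st.1 x)) => // j st' _ <-.
  by rewrite IHc //= upd_neq.
Qed.

Lemma den_stores_high N c st m :
  stores_high c -> m < N + N -> (den N c st).2 m = st.2 m.
Proof.
move=> + mN; elim: c st => [y e|e f|c IHc c' IHc'|e c IHc|y c IHc] st.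
- by [].
- case: e => // -[] // -[] // -[] // e _ /=.
  by rewrite upd_neq //; lia.
- by case/andP=> hc hc' /=; rewrite IHc' // IHc.
- by move=> hc /=; case: ifP => // _; apply: IHc.
- move=> hc; apply: (@for_ind N (fun _ st' => st'.2 m = st.2 m)) => //.
  by move=> j st' _ <-; rewrite IHc.
Qed.

(** * Boolean tests as arithmetic expressions *)

Definition eNot e := Minus (Cst 1) e.
Definition eAnd e f := eNot (Plus (eNot e) (eNot f)).
Definition eEq e f := eNot (Plus (Minus e f) (Minus f e)).
Definition eLt e f := Minus f e.
Definition eAll es := foldr eAnd (Cst 1) es.
Definition eIff (b : bool) e := if b then e else eNot e.

(** Any nonzero value counts as true, so a truncated difference or a memory cell is already a
    test. *)
Definition holds N st e := eval N st e != 0.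

Section Holds.
Variables (N : nat) (st : state).
Local Notation holds := (holds N st).

Lemma holds_not e : holds (eNot e) = ~~ holds e.
Proof. by rewrite /holds /=; lia. Qed.

Lemma holds_and e f : holds (eAnd e f) = holds e && holds f.
Proof. by rewrite /holds /=; lia. Qed.

Lemma holds_eq e f : holds (eEq e f) = (eval N st e == eval N st f).
Proof. by rewrite /holds /=; lia. Qed.

Lemma holds_lt e f : holds (eLt e f) = (eval N st e < eval N st f).
Proof. by rewrite /holds /=; lia. Qed.

Lemma holds_iff b e : holds (eIff b e) = (holds e == b).
Proof. by case: b; rewrite /eIff ?holds_not; case: (holds e). Qed.

Lemma holds_all es : holds (eAll es) = all holds es.
Proof. by elim: es => //= e es IH; rewrite holds_and IH. Qed.

Lemma holds_all_map (T : eqType) (F : T -> expr) (r : seq T) :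
  holds (eAll [seq F x | x <- r]) = all (fun x => holds (F x)) r.
Proof. by rewrite holds_all all_map. Qed.

End Holds.

Lemma nth_allpairs (S T R : Type) (f : S -> T -> R) r x0 y0
    (u : seq S) (v : seq T) i j :
  i < size u -> j < size v ->
  nth r [seq f x y | x <- u, y <- v] (i * size v + j) = f (nth x0 u i) (nth y0 v j).
Proof.
elim: u i => [|x u IH] [|i] //= iu jv; rewrite nth_cat size_map.
  by rewrite mul0n add0n jv (nth_map y0).
by rewrite ifF -?IH //; [congr nth|]; lia.
Qed.

(** Row [i] of the matrix starts at the address stored in cell [N + i]; cell
    [2 N + i] is nonzero when vertex [i] has been reached. *)
Definition eAdj e f := Deref (Plus (Deref (Plus Len e)) f).
Definition eCell e := Plus (Plus Len Len) e.
Definition eMark e := Deref (eCell e).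

Definition vn := 0.
Definition vans := 1.
Definition vq := 2.
Definition vx := 3.
Definition vy := 4.
Definition vt := 5.
(** The guess lies above the six working variables: first the [a w], then the [b w]. *)
Definition tv k := 6 + k.

(** * The program for fixed [H] and [s] *)

Section Program.
Variables (H : sgraph) (s : H).

Definition ea (w : H) := Var (tv (enum_rank w)).
Definition eb (w : H) := Var (tv (#|H| + enum_rank w)).

Definition eAllowed e :=
  eAll [seq eAnd (eNot (eEq e (ea w)))
                 (if edge s w then Cst 1 else eNot (eAdj e (ea w)))
       | w <- [seq w <- enum H | w != s]].

(** The loops over guesses reach beyond the number of vertices, so values that denote no vertex are
    rejected here. *)
Definition eBound :=
  eAll [seq eLt (Var (tv k)) (Var vn) | k <- iota 0 (#|H| + #|H|)].

Definition eInduced :=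
  eAll [seq eAnd (eNot (eEq (ea p.1) (ea p.2)))
                 (eIff (edge p.1 p.2) (eAdj (ea p.1) (ea p.2)))
       | p <- [seq p <- enum {: H * H} | [&& p.1 != s, p.2 != s & p.1 != p.2]]].

Definition eTouch :=
  eAll [seq eAnd (eMark (eb w)) (eAdj (eb w) (ea w))
       | w <- [seq w <- enum H | (w != s) && edge s w]].

(** Both indices run up to [N], whence the two range tests. [eAnd] evaluates all its operands, which
    is harmless as memory reads are total. *)
Definition relax :=
  When (eAnd (eLt (Var vx) (Var vn)) (eAnd (eLt (Var vy) (Var vn))
         (eAnd (eMark (Var vx)) (eAnd (eAdj (Var vx) (Var vy))
           (eAllowed (Var vy))))))
    (Store (eCell (Var vy)) (Cst 1)).

Definition round := For vx (For vy relax).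

Definition search :=
  Seq (For vx (Store (eCell (Var vx)) (Cst 0)))
    (Seq (Store (eCell (ea s)) (Cst 1)) (For vt round)).

(** [vans] is set but never reset, so it accumulates the disjunction over all guesses. *)
Definition body :=
  Seq search
    (When (eAnd eBound (eAnd eInduced (eAnd (eAllowed (ea s)) eTouch)))
      (Asgn vans (Cst 1))).

Fixpoint enumerate k := if k is k.+1 then For (tv k) (enumerate k) else body.

(** The number of vertices is the square root of [Len], found by adding up
    consecutive odd numbers; the second loop tabulates the row addresses. *)
Definition prelude :=
  Seq (For vt (When (Minus Len (Var vq))
        (Seq (Asgn vq (Plus (Plus (Var vq) (Cst 1)) (Plus (Var vn) (Var vn))))
             (Asgn vn (Plus (Var vn) (Cst 1))))))
    (Seq (Asgn vq (Cst 0))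
      (For vx (Seq (Store (Plus Len (Var vx)) (Var vq))
                   (Asgn vq (Plus (Var vq) (Var vn)))))).

Definition main := Seq prelude (enumerate (#|H| + #|H|)).

(** * Correctness of the program on a fixed graph *)

Section Correctness.
Variable G : sgraph.
Local Notation n := #|G|.
Local Notation N := (#|G| * #|G|).

(** Loops of length [N] therefore visit every vertex and suffice for reachability. *)
Let nN : n <= N. Proof. by nia. Qed.

Let rank (x : G) : nat := enum_rank x.
Let rank_lt x : rank x < n. Proof. exact: ltn_ord. Qed.
Let rank_inj : injective rank.
Proof. by move=> x y /val_inj/enum_rank_inj. Qed.
Let rank_surj i : i < n -> exists x, i = rank x.
Proof.
by move=> lt_in; exists (enum_val (Ordinal lt_in)); rewrite /rank enum_valK.
Qed.

Definition loaded (st : state) : Prop :=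
  [/\ st.1 vn = n, forall x, st.2 (N + rank x) = rank x * n
    & forall x y, st.2 (rank x * n + rank y) = edge x y].

Definition assigned (a b : H -> G) (v : nat -> nat) : Prop :=
  forall w, v (enum_rank w) = rank (a w) /\ v (#|H| + enum_rank w) = rank (b w).

Lemma loaded_eq (st st' : state) : loaded st -> st'.1 vn = st.1 vn ->
  (forall m, m < N + N -> st'.2 m = st.2 m) -> loaded st'.
Proof.
move=> [ln lt le] en em; split=> [|x|x y]; first by rewrite en.
  by rewrite em //; have := rank_lt x; lia.
by rewrite em //; have := rank_lt x; have := rank_lt y; nia.
Qed.

Lemma holds_adj st e f x y : loaded st ->
  eval N st e = rank x -> eval N st f = rank y -> holds N st (eAdj e f) = edge x y.
Proof.
by move=> [_ lt le] ex fy; rewrite /holds /= ex fy lt le; case: edge.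
Qed.

Section Marking.
Variables a b : H -> G.

Definition ctx (st : state) : Prop :=
  loaded st /\ assigned a b (fun k => st.1 (tv k)).

Definition marked (st : state) (x : G) : bool := st.2 (N + N + rank x) != 0.

(** The half of correctness that is invariant throughout the search; the converse needs enough
    rounds. *)
Definition sound (st : state) : Prop :=
  forall y, marked st y -> connect (bag_rel s a) (a s) y.

Lemma ctx_upd st x j : 0 < x < 6 -> ctx st -> ctx (upd st.1 x j, st.2).
Proof.
move=> x6 [ld asg]; split.
  by apply: loaded_eq ld _ _ => //=; rewrite upd_neq // /vn; lia.
by move=> w; rewrite /= !upd_neq; [apply: asg | rewrite /tv; lia ..].
Qed.

Lemma ctx_store st m v : N + N <= m -> ctx st -> ctx (st.1, upd st.2 m v).
Proof.
move=> Nm [ld asg]; split=> //.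
apply: loaded_eq ld _ _ => // m' m'N.
by rewrite [LHS]upd_neq // ltn_eqF //; apply: leq_trans Nm.
Qed.

Lemma eval_ea st w : ctx st -> eval N st (ea w) = rank (a w).
Proof. by case=> _ /(_ w)[]. Qed.

Lemma eval_eb st w : ctx st -> eval N st (eb w) = rank (b w).
Proof. by case=> _ /(_ w)[]. Qed.

Lemma holds_allowed st e y : ctx st -> eval N st e = rank y ->
  holds N st (eAllowed e) = allowed s a y.
Proof.
move=> cst ey; rewrite holds_all_map all_filter.
have E w : holds N st (eAnd (eNot (eEq e (ea w)))
    (if edge s w then Cst 1 else eNot (eAdj e (ea w)))) =
    (y != a w) && (edge s w || ~~ edge y (a w)).
  rewrite holds_and holds_not holds_eq ey eval_ea // (inj_eq rank_inj).
  by case: (edge s w) => //; rewrite holds_not (holds_adj cst.1 ey (eval_ea w cst)).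
apply/allP/forallP => [al w|al w _] /=; last by rewrite E; apply: al.
by have /= := al w; rewrite mem_enum E => /(_ isT).
Qed.

Lemma marked_store st y v z :
  marked (st.1, upd st.2 (N + N + rank y) v) z =
    if z == y then v != 0 else marked st z.
Proof.
rewrite /marked /= /upd; case: (eqVneq z y) => [->|zy]; first by rewrite eqxx.
by rewrite eqn_add2l (inj_eq rank_inj) (negbTE zy).
Qed.

Lemma relax_spec st : ctx st -> sound st ->
  [/\ ctx (den N relax st), sound (den N relax st),
      forall y, marked st y -> marked (den N relax st) y
    & forall x y, st.1 vx = rank x -> st.1 vy = rank y ->
        marked st x -> bag_rel s a x y -> marked (den N relax st) y].
Proof.
move=> cst snd.
have -> : den N relax st = if holds N st (eAnd (eLt (Var vx) (Var vn))
    (eAnd (eLt (Var vy) (Var vn)) (eAnd (eMark (Var vx))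
      (eAnd (eAdj (Var vx) (Var vy)) (eAllowed (Var vy))))))
    then (st.1, upd st.2 (N + N + st.1 vy) 1) else st.
  by rewrite /relax /holds [den _ _ _]/=; case: (_ == 0).
have vnE : st.1 vn = n by case: cst => -[].
rewrite !holds_and !holds_lt /= vnE.
case: ltnP => [/rank_surj[x ex]|hx] /=; last first.
  by split=> // x y ex; move: hx; rewrite ex leqNgt rank_lt.
case: ltnP => [/rank_surj[y ey]|hy] /=; last first.
  by split=> // x' y _ ey; move: hy; rewrite ey leqNgt rank_lt.
have -> : holds N st (eMark (Var vx)) = marked st x by rewrite /holds /= ex.
rewrite (holds_adj (x := x) (y := y) cst.1) // (holds_allowed (y := y) cst) //.
rewrite -/(bag_rel s a x y) ey; case: ifP => [/andP[mx xy]|nxy].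
  split=> [|z|z mz|x' y' ex' ey' mx' xy'].
  - by apply: ctx_store => //; apply: leq_addr.
  - rewrite marked_store; case: eqP => [-> _|_ /snd //].
    exact: connect_trans (snd x mx) (connect1 xy).
  - by rewrite marked_store mz; case: eqP.
  - by rewrite marked_store -(rank_inj ey') eqxx.
split=> // x' y' ex' ey' mx' xy'.
by move: nxy; rewrite (rank_inj (etrans (esym ex) ex')) (rank_inj ey') mx' xy'.
Qed.

(** The marks are updated in place and may spread further within one round; only one step from the
    initial marks is claimed. The case [x == y] expresses that marks persist. *)
Lemma round_spec st : ctx st -> sound st ->
  [/\ ctx (den N round st), sound (den N round st)
    & forall x y, marked st x -> (x == y) || bag_rel s a x y ->
        marked (den N round st) y].
Proof.
move=> cst snd.
pose I i st' := [/\ ctx st', sound st', forall y, marked st y -> marked st' y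
  & forall x y, rank x < i -> marked st x -> bag_rel s a x y -> marked st' y].
suff [? ? mono cl] : I N (den N round st).
  split=> // x y mx /orP[/eqP <-|xy]; first exact: mono.
  by apply: (cl x) => //; apply: leq_trans nN.
apply: for_ind => // i st1 iN [cst1 snd1 mono1 cl1].
pose J j st' := [/\ ctx st', sound st', st'.1 vx = i,
  forall y, marked st1 y -> marked st' y
  & forall x y, rank x = i -> rank y < j -> marked st x -> bag_rel s a x y ->
      marked st' y].
suff [? ? _ mono cl] : J N (den N (For vy relax) (upd st1.1 vx i, st1.2)).
  split=> // [y /mono1/mono //|x y xi mx xy].
  have [xi'|xi'] : rank x < i \/ rank x = i by lia.
    exact/mono/(cl1 x).
  by apply: (cl x) => //; apply: leq_trans nN.
apply: for_ind => [|j st2 jN [cst2 snd2 xi mono2 cl2]].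
  by split=> //; apply: ctx_upd.
set st3 := (upd _ _ _, _).
have cst3 : ctx st3 by apply: ctx_upd.
have [c3 s3 m3 cl3] := relax_spec cst3 snd2.
split=> //.
- by rewrite den_writes //= upd_neq.
- by move=> y my; apply: m3; apply: mono2.
move=> x y ex yj mx xy.
have [yj'|yj'] : rank y < j \/ rank y = j by lia.
  by apply: m3; apply: (cl2 x).
apply: (cl3 x) => //=.
  by rewrite upd_neq // xi.
by apply: mono2; apply: mono1.
Qed.

(** After [j] rounds the end of each walk of length at most [j] from [a s] is marked, and a simple
    path has length less than the number of vertices. *)
Lemma search_spec st : ctx st ->
  ctx (den N search st) /\
  forall y, marked (den N search st) y = connect (bag_rel s a) (a s) y.
Proof.
move=> cst.
set st1 := den N (For vx (Store (eCell (Var vx)) (Cst 0))) st.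
(* Marks left by an earlier guess are erased. *)
have [cst1 m1] : ctx st1 /\ forall y, rank y < N -> ~~ marked st1 y.
  pose I j st' := ctx st' /\ forall y, rank y < j -> ~~ marked st' y.
  apply: (@for_ind N I) => // j st' jN [c' m']; split.
    by apply: (ctx_store (st := (upd _ _ _, _))); [apply: leq_addr | exact: ctx_upd].
  move=> y yj; change (~~ (upd st'.2 (N + N + j) 0 (N + N + rank y) != 0)).
  have [yj'|yj'] : rank y = j \/ rank y < j by lia.
    by rewrite yj' upd_eq.
  by rewrite upd_neq; [apply: m' | rewrite eqn_add2l ltn_eqF].
set st2 := den N (Store (eCell (ea s)) (Cst 1)) st1.
have cst2 : ctx st2 by apply: ctx_store cst1; apply: leq_addr.
have m2 y : marked st2 y = (y == a s).
  have -> : st2 = (st1.1, upd st1.2 (N + N + rank (a s)) 1).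
    by rewrite -(eval_ea s cst1).
  rewrite marked_store; case: eqP => // _; apply/negbTE/m1.
  exact: leq_trans (rank_lt y) nN.
have -> : den N search st = den N (For vt round) st2 by [].
have [cst3 snd3 cl3] : [/\ ctx (den N (For vt round) st2),
    sound (den N (For vt round) st2) & forall p, size p <= N ->
      path (bag_rel s a) (a s) p ->
      marked (den N (For vt round) st2) (last (a s) p)].
  pose I j st' := [/\ ctx st', sound st' & forall p, size p <= j ->
    path (bag_rel s a) (a s) p -> marked st' (last (a s) p)].
  apply: (@for_ind N I) => [|j st' jN [c' s' cl']].
    split=> // [y|p]; first by rewrite m2 => /eqP ->.
    by rewrite leqn0 => /nilP -> _; rewrite m2 /=.
  have c'' : ctx (upd st'.1 vt j, st'.2) by apply: ctx_upd.
  have [c3 s3 cl3] := round_spec c'' s'.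
  split=> // p; elim/last_ind: p => [_ _|p z _].
    by apply: (cl3 (a s)); [apply: (cl' [::]) | rewrite eqxx].
  rewrite size_rcons rcons_path last_rcons => pj /andP[pp pz].
  by apply: (cl3 (last (a s) p)); [apply: cl' | rewrite pz orbT].
split=> // y; apply/idP/idP => [/snd3 //|/connectP[p0 pp0 ->]].
case/shortenP: pp0 => p pp up _; apply: cl3 => //.
apply: leq_trans nN; apply: ltnW.
by have := card_uniqP up; rewrite /= => <-; apply: max_card.
Qed.

End Marking.

(** The guess may be out of range: then [eBound] fails, and no [a] and [b] are assigned either. *)
Lemma body_spec st : loaded st ->
  loaded (den N body st) /\
  ((den N body st).1 vans <> 0 <-> st.1 vans <> 0 \/
     exists a b, assigned a b (fun k => st.1 (tv k)) /\ certificate s a b).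
Proof.
move=> ld; split.
  apply: loaded_eq ld _ _ => [|m mN]; first exact: den_writes.
  exact: den_stores_high.
set st1 := den N search st.
have ld1 : loaded st1.
  apply: loaded_eq ld _ _ => [|m mN]; first exact: den_writes.
  exact: den_stores_high.
have tv1 k : st1.1 (tv k) = st.1 (tv k) by apply: den_writes.
have ans1 : st1.1 vans = st.1 vans by apply: den_writes.
have -> : den N body st = if holds N st1
    (eAnd eBound (eAnd eInduced (eAnd (eAllowed (ea s)) eTouch)))
    then (upd st1.1 vans 1, st1.2) else st1.
  by rewrite /body /holds [den _ _ _]/=; case: (_ == 0).
set test := eAnd eBound _.
suff testP : holds N st1 test <->
    exists a b, assigned a b (fun k => st.1 (tv k)) /\ certificate s a b.
  case: ifP => [/testP cert|ntest]; first by split=> // _; right.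
  by rewrite ans1; split=> [ans|[//|/testP]]; [left | rewrite ntest].
have key a b : assigned a b (fun k => st.1 (tv k)) ->
    holds N st1 (eAnd eInduced (eAnd (eAllowed (ea s)) eTouch)) <->
    certificate s a b.
  move=> asg; have [cst1 mk] := search_spec (conj ld asg).
  rewrite -/st1 in cst1 mk.
  rewrite !holds_and (holds_allowed cst1 (eval_ea s cst1)).
  rewrite !holds_all_map !all_filter.
  have indE w w' : holds N st1 (eAnd (eNot (eEq (ea w) (ea w')))
      (eIff (edge w w') (eAdj (ea w) (ea w')))) =
      (a w != a w') && (edge (a w) (a w') == edge w w').
    rewrite holds_and holds_not holds_eq holds_iff.
    rewrite (holds_adj cst1.1 (eval_ea w cst1) (eval_ea w' cst1)).
    by rewrite !(eval_ea _ cst1) (inj_eq rank_inj).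
  have touchE w : holds N st1 (eAnd (eMark (eb w)) (eAdj (eb w) (ea w))) =
      connect (bag_rel s a) (a s) (b w) && edge (b w) (a w).
    rewrite holds_and (holds_adj cst1.1 (eval_eb w cst1) (eval_ea w cst1)) -mk.
    by rewrite /marked -(eval_eb w cst1).
  split=> [/and3P[/allP ind al /allP touch]|[ind al touch]].
    split=> // [w w' ws ws' ww'|w ws sw].
      have /= := ind (w, w'); rewrite -enumT mem_enum ws ws' ww' indE.
      by case/(_ isT)/andP=> ? /eqP.
    have /= := touch w; rewrite -enumT mem_enum ws sw touchE.
    by case/(_ isT)/andP.
  apply/and3P; split=> //; apply/allP.
    move=> [w w'] _ /=; apply/implyP => /and3P[ws ws' ww'].
    by rewrite indE; have [-> ->] := ind w w' ws ws' ww'; rewrite eqxx.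
  move=> w _ /=; apply/implyP => /andP[ws sw].
  by rewrite touchE; have [-> ->] := touch w ws sw.
have vn1 : st1.1 vn = n by case: ld1.
have boundE : holds N st1 eBound =
    all (fun k => st.1 (tv k) < n) (iota 0 (#|H| + #|H|)).
  rewrite holds_all_map; apply: eq_all => k.
  by rewrite holds_lt [eval _ _ _]/= tv1 [eval _ _ _]vn1.
rewrite holds_and boundE; split.
  case/andP=> /allP bnd test2.
  have bnd' k : k < #|H| + #|H| -> exists x, st.1 (tv k) = rank x.
    by move=> kH; apply: rank_surj; apply: bnd; rewrite mem_iota.
  have /fin_all_exists[a aP] (w : H) : exists x, st.1 (tv (enum_rank w)) = rank x.
    by apply: bnd'; apply: ltn_addr; apply: ltn_ord.
  have /fin_all_exists[b bP] (w : H) :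
      exists x, st.1 (tv (#|H| + enum_rank w)) = rank x.
    by apply: bnd'; rewrite ltn_add2l; apply: ltn_ord.
  have asg : assigned a b (fun k => st.1 (tv k)) by move=> w; rewrite aP bP.
  by exists a, b; split=> //; apply/key.
case=> a [b [asg cert]]; rewrite andbC; apply/andP; split; first exact/(key a b).
(* An index below [#|H|] holds a value of [a], a later one a value of [b]. *)
apply/allP => k; rewrite mem_iota add0n => /= kH.
have [kH'|kH'] := ltnP k #|H|.
  have [+ _] := asg (enum_val (Ordinal kH')).
  by rewrite enum_valK => -> ; apply: rank_lt.
have kH2 : k - #|H| < #|H| by rewrite ltn_subLR.
have [_] := asg (enum_val (Ordinal kH2)).
by rewrite enum_valK /= subnKC // => ->; apply: rank_lt.
Qed.

(** Hence the inner loops leave the guess variables of the outer ones unchanged. *)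
Lemma enumerate_writes k x : writes (enumerate k) x -> x < tv k.
Proof.
elim: k => [|k IH] /=; rewrite /tv; first by rewrite /vt /vx /vy /vans; lia.
by case/orP => [/eqP ->|/IH]; rewrite /tv; lia.
Qed.

(** Induction on the depth of the nest, each loop supplying one more value of the guess [v]. The
    values are bounded by [N], the common length of all loops. *)
Lemma enumerate_spec k st : loaded st ->
  loaded (den N (enumerate k) st) /\
  ((den N (enumerate k) st).1 vans <> 0 <-> st.1 vans <> 0 \/
     exists v a b, [/\ forall i, k <= i -> v i = st.1 (tv i),
       forall i, i < k -> v i < N, assigned a b v & certificate s a b]).
Proof.
elim: k st => [|k IH] st ld.
  have [ld' bP] := body_spec ld; split=> //=; rewrite bP.
  split=> -[ans|]; try by left.
    case=> a [b [asg cert]]; right; exists (fun k => st.1 (tv k)), a, b; split=> //.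
  case=> v [a [b [vE _ asg cert]]]; right; exists a, b; split=> // w.
  by rewrite -!vE.
(* The strict [k < i] leaves out [tv k], the variable of this loop; [v k < j] restricts to the
   values already tried. *)
pose I j st' := [/\ loaded st', forall i, k < i -> st'.1 (tv i) = st.1 (tv i)
  & st'.1 vans <> 0 <-> st.1 vans <> 0 \/
     exists v a b, [/\ forall i, k < i -> v i = st.1 (tv i),
       forall i, i < k -> v i < N, v k < j, assigned a b v & certificate s a b]].
have [] : I N (den N (enumerate k.+1) st).
  apply: for_ind => [|j st' jN [ld' keep ansE]].
    by split=> //; split=> [ans|[//|[v [a [b []]]]]] //; left.
  set st2 := (upd _ _ _, _).
  have ld2 : loaded st2 by apply: loaded_eq ld' _ _.
  have [ld3 ans3] := IH st2 ld2.
  split=> // [i ki|].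
    rewrite den_writes; last by apply/negP => /enumerate_writes; rewrite /tv; lia.
    by rewrite /st2 /= upd_neq ?keep // /tv; lia.
  rewrite ans3 [st2.1 vans]upd_neq // ansE.
  split=> [[[ans|]|]|[ans|]]; try by left; left.
  - by left.
  - case=> v [a [b [v1 v2 vk asg cert]]]; right; exists v, a, b; split=> //.
    exact: ltnW.
  - case=> v [a [b [v1 v2 asg cert]]]; right; exists v, a, b; split=> //.
      move=> i ki; rewrite v1 ?(ltnW ki) // /st2 /= upd_neq ?keep // /tv; lia.
    by rewrite v1 // /st2 /= upd_eq.
  - case=> v [a [b [v1 v2 vk asg cert]]].
    have [vj|vj] : v k < j \/ v k = j by lia.
      by left; right; exists v, a, b.
    right; exists v, a, b; split=> // i.
    rewrite leq_eqVlt => /predU1P[<-|ki]; first by rewrite /st2 /= upd_eq.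
    by rewrite v1 // /st2 /= upd_neq ?keep // /tv; lia.
move=> ld' _ ->; split=> //; split=> -[ans|]; try by left.
  case=> v [a [b [v1 v2 vk asg cert]]]; right; exists v, a, b; split=> // i.
  by rewrite ltnS leq_eqVlt => /predU1P[->|/v2].
case=> v [a [b [v1 v2 asg cert]]]; right; exists v, a, b; split=> //.
  by move=> i ik; apply: v2; apply: ltnW.
exact: v2.
Qed.

Lemma prelude_spec (st := den N prelude (input (adjacency_matrix G))) :
  loaded st /\ st.1 vans = 0.
Proof.
set A := adjacency_matrix G.
pose c1 := When (Minus Len (Var vq))
  (Seq (Asgn vq (Plus (Plus (Var vq) (Cst 1)) (Plus (Var vn) (Var vn))))
       (Asgn vn (Plus (Var vn) (Cst 1)))).
pose st1 := den N (For vt c1) (input A).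
have [n1 _ m1] : [/\ st1.1 vn = minn N n, st1.1 vq = minn N n * minn N n
    & st1.2 = (input A).2].
  (* [minn] records that the updates stop once the square in [vq] reaches [N], while the loop itself
     goes on. *)
  pose I j (st' : state) := [/\ st'.1 vn = minn j n, st'.1 vq = minn j n * minn j n
    & st'.2 = (input A).2].
  apply: (@for_ind N I) => [|j st' jN [en eq em]]; first by split; rewrite ?min0n.
  have -> : den N c1 (upd st'.1 vt j, st'.2) =
     if N <= st'.1 vq then (upd st'.1 vt j, st'.2) else
      (upd (upd (upd st'.1 vt j) vq (st'.1 vq + 1 + (st'.1 vn + st'.1 vn)))
        vn (st'.1 vn + 1), st'.2).
    by rewrite /c1 [LHS]/= -subn_eq0.
  have -> : (N <= st'.1 vq) = (n <= j).
    by rewrite eq !mulnn leq_sqr leq_min leqnn andbT.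
  case: (leqP n j) => jn; rewrite /I.
    have -> : minn j.+1 n = minn j n by rewrite !(minn_idPr _) // ltnW.
    by split.
  rewrite (minn_idPl jn); move: en eq; rewrite (minn_idPl (ltnW jn)) => en eq.
  by split=> //=; [rewrite [LHS]upd_eq | rewrite [LHS]upd_neq // upd_eq]; lia.
pose c2 := Seq (Store (Plus Len (Var vx)) (Var vq))
  (Asgn vq (Plus (Var vq) (Var vn))).
pose st2 := den N (Asgn vq (Cst 0)) st1.
have Est : st = den N (For vx c2) st2 by [].
have n2 : st2.1 vn = n by rewrite /st2 /= upd_neq // n1; apply/minn_idPr.
have [n3 _ m3 t3] : [/\ st.1 vn = n, st.1 vq = N * n,
    forall m, m < N -> st.2 m = (input A).2 m
    & forall m, m < N -> st.2 (N + m) = m * n].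
  pose I j (st' : state) := [/\ st'.1 vn = n, st'.1 vq = j * n,
    forall m, m < N -> st'.2 m = (input A).2 m
    & forall m, m < j -> st'.2 (N + m) = m * n].
  rewrite Est; apply: (@for_ind N I) => [|j st' jN [en eq em et]].
    by split=> //; rewrite -m1.
  have -> : den N c2 (upd st'.1 vx j, st'.2) =
     (upd (upd st'.1 vx j) vq (st'.1 vq + st'.1 vn),
      upd st'.2 (N + j) (st'.1 vq)) by [].
  split=> // [|m mN|m mj].
  - by rewrite [LHS]upd_eq eq en mulSn addnC.
  - by rewrite [LHS]upd_neq ?em // ltn_eqF //; apply: ltn_addr.
  - rewrite leq_eqVlt eqSS in mj; case/predU1P: mj => [->|mj].
      by rewrite [LHS]upd_eq.
    by rewrite [LHS]upd_neq ?et // eqn_add2l ltn_eqF.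
split; last by rewrite /st den_writes.
split=> // [x|x y]; first by apply: t3; apply: leq_trans (rank_lt x) nN.
rewrite m3; last by have := rank_lt x; have := rank_lt y; nia.
rewrite /= /A /adjacency_matrix cardE (nth_allpairs _ _ x y) -?cardE //.
by rewrite /rank !nth_enum_rank.
Qed.

Lemma main_spec :
  (den (size (adjacency_matrix G)) main (input (adjacency_matrix G))).1 vans <> 0
  <-> exists a b : H -> G, certificate s a b.
Proof.
have -> : size (adjacency_matrix G) = N by rewrite size_allpairs -!cardE.
have [ld ans0] := prelude_spec.
have [_] := enumerate_spec (#|H| + #|H|) ld.
rewrite ans0 -[den N (enumerate _) _]/(den N main _) => ->.
split=> [[//|[v [a [b [_ _ _ cert]]]]]|[a [b cert]]]; first by exists a, b.
(* The guess that encodes the certificate: the ranks of all [a w], then of all [b w]. Beyond them it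
   must agree with the current state. *)
right; pose v k := if k < #|H| + #|H| then
  nth 0 ([seq rank (a w) | w <- enum H] ++ [seq rank (b w) | w <- enum H]) k
  else (den N prelude (input (adjacency_matrix G))).1 (tv k).
have asg : assigned a b v.
  move=> w; have wH := ltn_ord (enum_rank w).
  rewrite /v ltn_addr // ltn_add2l wH !nth_cat size_map -cardE wH ltnNge leq_addr /=.
  by rewrite addKn !(nth_map w) -?enumT -?cardE // nth_enum_rank.
exists v, a, b; split=> // [i|i iH]; first by rewrite /v ltnNge => ->.
apply: leq_trans nN; rewrite /v iH.
apply: (all_nthP 0 (a := fun x => x < n) _ i); last first.
  by rewrite size_cat !size_map -?enumT -cardE.
by rewrite all_cat !all_map; apply/andP; split; apply/allP => w _ /=.
Qed.

End Correctness.
End Program.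

Theorem theorem3p5 (H : sgraph) (S : {set H})
  (S_le1 : #|S| <= 1) (S_nontriv : non_trivial S) :
  polytime_decidable adjacency_matrix (fun G : sgraph => induced_minor H G).
Proof.
(* [main] requires a vertex [s]. If [H] is empty, the empty family is a model in every graph and a
   constant answer is correct. *)
case: (pickP (mem H)) => [w0 _|H0]; last first.
  apply: (cmd_polytime_decidable (c := Asgn vans (Cst 1)) (ans := vans)) => G.
  split=> // _; apply: (@model_induced_minor H G (fun=> set0)).
  by split=> w; have := H0 w.
(* If [S] is empty, any vertex of [H] may serve as [s]. *)
have [s Ss] : exists s, S \subset [set s].
  have [->|[s sS]] := set_0Vmem S; first by exists w0; apply: sub0set.
  exists s; apply/subsetP => x xS; rewrite inE.
  by have /card_le1_eqP/(_ _ _ xS sS) -> := S_le1.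
apply: (cmd_polytime_decidable (c := main s) (ans := vans)) => G.
(* Non-triviality enters in the backward direction: it yields a model with singleton bags outside
   [S], hence away from [s]. *)
rewrite main_spec; split=> [[a [b]]|/S_nontriv[X modelX X1]].
  by case/certificate_model=> X; apply: model_induced_minor.
apply: model_certificate modelX _ => w ws; apply: X1.
by apply: contra ws => /(subsetP Ss); rewrite inE.
Qed.
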